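(* Let $\mathcal{C}$ be a category with Kähler differentials (in particular, $\mathcal{C}$ has pullbacks). Let $X$ be an object of $\mathcal{C}$. Then $X$ is formally unramified if and only if $\Omega_X$ is a zero object in $\mathrm{Ab}(\mathcal{C}/X)$.
   Context: Let $\mathcal{C}$ be a category with pullbacks. For an object $X$ of $\mathcal{C}$, the overcategory $\mathcal{C}/X$ has finite products (given by pullbacks over $X$) and terminal object $\mathrm{id}_X: X\to X$. Beck modules: A Beck module over $X$ is a morphism $M\to X$ in $\mathcal{C}$ together with the structure of an abelian group object in $\mathcal{C}/X$. Morphisms of Beck modules over $X$ are morphisms of abelian group objects in $\mathcal{C}/X$; the resulting category is denoted $\mathrm{Ab}(\mathcal{C}/X)$. Effective epimorphism: A morphism $Z\to Y$ in $\mathcal{C}$ is an effective epimorphism if $Z\times_Y Z\rightrightarrows Z\to Y$ (the two projections followed by the given morphism) is a coequalizer diagram. Beck torsors: A Beck torsor in $\mathcal{C}$ is an effective epimorphism $Z\to Y$ in $\mathcal{C}$ together with a Beck module $M$ over $Y$ and a group action $\tau: M\times_Y Z\to Z$ in $\mathcal{C}/Y$ (of the group object $M$ on the object $Z\to Y$ of $\mathcal{C}/Y$) such that $(\tau,\pi_Z): M\times_Y Z\to Z\times_Y Z$ is an isomorphism in $\mathcal{C}/Y$, where $\pi_Z: M\times_Y Z\to Z$ is the projection. Formally unramified objects: An object $X$ of $\mathcal{C}$ is formally unramified if, for every Beck torsor $Z\to Y$ in $\mathcal{C}$ (for any object $Y$), the canonical map $\mathrm{Hom}_{\mathcal{C}}(X,Z)\to\mathrm{Hom}_{\mathcal{C}}(X,Y)$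 given by composition with $Z\to Y$ is injective. Kähler differentials: A category $\mathcal{C}$ with pullbacks has Kähler differentials if, for each object $X$ of $\mathcal{C}$, the forgetful functor $\mathrm{Ab}(\mathcal{C}/X)\to\mathcal{C}/X$ has a left adjoint $\Omega:\mathcal{C}/X\to\mathrm{Ab}(\mathcal{C}/X)$. One writes $\Omega_X=\Omega(\mathrm{id}_X)$, where $\mathrm{id}_X: X\to X$ is viewed as an object of $\mathcal{C}/X$. *)

(* Defs.v *)
From Stdlib Require Import ProofIrrelevance.
From mathcomp Require Import ssreflect ssrfun.

Set Implicit Arguments.
Unset Strict Implicit.
Unset Printing Implicit Defensive.

Record category : Type := Category {
  ob :> Type;
  hom : ob -> ob -> Type;
  idm : forall X, hom X X;
  compose : forall X Y Z, hom Y Z -> hom X Y -> hom X Z;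
  compose1m : forall X Y (f : hom X Y), compose (idm Y) f = f;
  composem1 : forall X Y (f : hom X Y), compose f (idm X) = f;
  composeA : forall W X Y Z (h : hom Y Z) (g : hom X Y) (f : hom W X),
    compose h (compose g f) = compose (compose h g) f
}.
Arguments hom {c} _ _.
Arguments idm {c} _.
Arguments compose {c X Y Z} _ _.

Declare Scope cat_scope.
Delimit Scope cat_scope with cat.
Local Open Scope cat_scope.
Notation "g ∘ f" := (compose g f) (at level 40, left associativity) : cat_scope.

Definition is_iso (C : category) (X Y : C) (f : hom X Y) : Prop :=
  exists g : hom Y X, g ∘ f = idm X /\ f ∘ g = idm Y.

Definition is_initial (C : category) (X : C) : Prop :=
  forall Y : C, exists! f : hom X Y, True.

Definition is_terminal (C : category) (X : C) : Prop :=
  forall Y : C, exists! f : hom Y X, True.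

Definition is_zero_object (C : category) (X : C) : Prop :=
  is_initial X /\ is_terminal X.

Definition is_coequalizer (C : category) (A B Q : C)
    (u v : hom A B) (q : hom B Q) : Prop :=
  q ∘ u = q ∘ v /\
  forall (W : C) (t : hom B W), t ∘ u = t ∘ v ->
    exists! h : hom Q W, h ∘ q = t.

Record functor (C D : category) : Type := Functor {
  fobj :> C -> D;
  fmap : forall X Y : C, hom X Y -> hom (fobj X) (fobj Y);
  fmap1 : forall X, fmap (idm X) = idm (fobj X);
  fmapM : forall X Y Z (g : hom Y Z) (f : hom X Y),
    fmap (g ∘ f) = fmap g ∘ fmap f
}.
Arguments fmap {C D} _ {X Y} _.

Record left_adjoint (C D : category) (G : functor D C) : Type := LeftAdjoint {
  ladj :> functor C D;
  transpose : forall (X : C) (Y : D), hom (ladj X) Y -> hom X (G Y);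
  transpose_bij : forall (X : C) (Y : D), bijective (@transpose X Y);
  transpose_nat : forall (X X' : C) (Y Y' : D)
      (a : hom X' X) (f : hom (ladj X) Y) (b : hom Y Y'),
    transpose (b ∘ f ∘ fmap ladj a) = fmap G b ∘ transpose f ∘ a
}.

Record pullback (C : category) (X Y S : C) (f : hom X S) (g : hom Y S) : Type :=
  Pullback {
    pb_ob :> C;
    pb_fst : hom pb_ob X;
    pb_snd : hom pb_ob Y;
    pb_comm : f ∘ pb_fst = g ∘ pb_snd;
    pb_pair : forall (W : C) (a : hom W X) (b : hom W Y),
      f ∘ a = g ∘ b -> hom W pb_ob;
    pb_fst_pair : forall W a b (e : f ∘ a = g ∘ b),
      pb_fst ∘ @pb_pair W a b e = a;
    pb_snd_pair : forall W a b (e : f ∘ a = g ∘ b),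
      pb_snd ∘ @pb_pair W a b e = b;
    pb_ext : forall (W : C) (h k : hom W pb_ob),
      pb_fst ∘ h = pb_fst ∘ k -> pb_snd ∘ h = pb_snd ∘ k -> h = k
  }.
Arguments pb_fst {C X Y S f g} _.
Arguments pb_snd {C X Y S f g} _.
Arguments pb_pair {C X Y S f g} _ {W a b} _.

(* Pullbacks are chosen; theorems quantify over every choice. *)
Definition pullbacks (C : category) : Type :=
  forall (X Y S : C) (f : hom X S) (g : hom Y S), pullback f g.

Record finite_products (D : category) : Type := FiniteProducts {
  one : D;
  to_one : forall X : D, hom X one;
  to_one_ext : forall (X : D) (f g : hom X one), f = g;
  prodo : D -> D -> D;
  pr1 : forall X Y, hom (prodo X Y) X;
  pr2 : forall X Y, hom (prodo X Y) Y;
  pairm : forall W X Y, hom W X -> hom W Y -> hom W (prodo X Y);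
  pr1_pairm : forall W X Y (a : hom W X) (b : hom W Y), pr1 X Y ∘ pairm a b = a;
  pr2_pairm : forall W X Y (a : hom W X) (b : hom W Y), pr2 X Y ∘ pairm a b = b;
  prodo_ext : forall W X Y (h k : hom W (prodo X Y)),
    pr1 X Y ∘ h = pr1 X Y ∘ k -> pr2 X Y ∘ h = pr2 X Y ∘ k -> h = k
}.
Arguments one {D} _.
Arguments to_one {D} _ _.
Arguments prodo {D} _ _ _.
Arguments pr1 {D} _ {X Y}.
Arguments pr2 {D} _ {X Y}.
Arguments pairm {D} _ {W X Y} _ _.

Arguments FiniteProducts {D one} to_one _ {prodo pr1 pr2 pairm} _ _ _.

Record over (C : category) (X : C) : Type := Over {
  over_ob : C;
  over_arr : hom over_ob X
}.
Arguments Over {C X over_ob} _.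

Record over_hom (C : category) (X : C) (A B : over X) : Type := OverHom {
  over_mor :> hom (over_ob A) (over_ob B);
  over_comm : over_arr B ∘ over_mor = over_arr A
}.
Arguments OverHom {C X A B over_mor} _.

Lemma over_hom_ext (C : category) (X : C) (A B : over X) (f g : over_hom A B) :
  over_mor f = over_mor g -> f = g.
Proof.
case: f g => [f ef] [g eg] /= e; subst g.
by rewrite (proof_irrelevance _ ef eg).
Qed.

Section Overcategory.
Variables (C : category) (X : C).
Implicit Types A B D E : over X.

Definition over_id A : over_hom A A := OverHom (composem1 (over_arr A)).

Lemma over_comp_comm A B D (g : over_hom B D) (f : over_hom A B) :
  over_arr D ∘ (over_mor g ∘ over_mor f) = over_arr A.
Proof. by rewrite composeA !over_comm. Qed.

Definition over_comp A B D (g : over_hom B D) (f : over_hom A B) :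
  over_hom A D := OverHom (over_comp_comm g f).

Lemma over_comp1m A B (f : over_hom A B) : over_comp (over_id B) f = f.
Proof. by apply: over_hom_ext; apply: compose1m. Qed.

Lemma over_compm1 A B (f : over_hom A B) : over_comp f (over_id A) = f.
Proof. by apply: over_hom_ext; apply: composem1. Qed.

Lemma over_compA A B D E
    (h : over_hom D E) (g : over_hom B D) (f : over_hom A B) :
  over_comp h (over_comp g f) = over_comp (over_comp h g) f.
Proof. by apply: over_hom_ext; apply: composeA. Qed.

Definition overcategory : category :=
  Category over_comp1m over_compm1 over_compA.

End Overcategory.

Definition over_idm (C : category) (X : C) : overcategory X := Over (idm X).

Section OverProducts.
Variables (C : category) (P : pullbacks C) (X : C).
Implicit Types A B W : overcategory X.

Lemma over_to_one_comm A : over_arr (over_idm X) ∘ over_arr A = over_arr A.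
Proof. exact: compose1m. Qed.

Definition over_to_one A : hom A (over_idm X) := OverHom (over_to_one_comm A).

Lemma over_to_one_ext A (f g : hom A (over_idm X)) : f = g.
Proof.
apply: over_hom_ext.
have e (h : hom A (over_idm X)) : over_mor h = over_arr A.
  by rewrite -(over_comm h) /= compose1m.
by rewrite !e.
Qed.

Definition over_prod_pb A B : pullback (over_arr A) (over_arr B) :=
  P (over_arr A) (over_arr B).

Definition over_prod A B : overcategory X :=
  Over (over_arr A ∘ pb_fst (over_prod_pb A B)).

Definition over_fst A B : hom (over_prod A B) A :=
  @OverHom _ _ (over_prod A B) A (pb_fst (over_prod_pb A B)) (erefl _).

Definition over_snd A B : hom (over_prod A B) B :=
  @OverHom _ _ (over_prod A B) B (pb_snd (over_prod_pb A B))
    (esym (pb_comm (over_prod_pb A B))).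

Lemma over_pair_eq W A B (a : hom W A) (b : hom W B) :
  over_arr A ∘ over_mor a = over_arr B ∘ over_mor b.
Proof. by rewrite !over_comm. Qed.

Lemma over_pair_comm W A B (a : hom W A) (b : hom W B) :
  over_arr (over_prod A B) ∘ pb_pair (over_prod_pb A B) (over_pair_eq a b)
  = over_arr W.
Proof. by rewrite /= -composeA pb_fst_pair over_comm. Qed.

Definition over_pair W A B (a : hom W A) (b : hom W B) :
  hom W (over_prod A B) := OverHom (over_pair_comm a b).

Lemma over_fst_pair W A B (a : hom W A) (b : hom W B) :
  over_fst A B ∘ over_pair a b = a.
Proof. by apply: over_hom_ext; apply: pb_fst_pair. Qed.

Lemma over_snd_pair W A B (a : hom W A) (b : hom W B) :
  over_snd A B ∘ over_pair a b = b.
Proof. by apply: over_hom_ext; apply: pb_snd_pair. Qed.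

Lemma over_pair_ext W A B (h k : hom W (over_prod A B)) :
  over_fst A B ∘ h = over_fst A B ∘ k ->
  over_snd A B ∘ h = over_snd A B ∘ k -> h = k.
Proof.
move=> e1 e2; apply: over_hom_ext; apply: pb_ext.
  exact: (f_equal (@over_mor _ _ _ _) e1).
exact: (f_equal (@over_mor _ _ _ _) e2).
Qed.

Definition over_products : finite_products (overcategory X) :=
  FiniteProducts over_to_one over_to_one_ext
    over_fst_pair over_snd_pair over_pair_ext.

End OverProducts.

Record group_object (D : category) (P : finite_products D) : Type :=
  GroupObject {
    g_ob :> D;
    g_add : hom (prodo P g_ob g_ob) g_ob;
    g_zero : hom (one P) g_ob;
    g_opp : hom g_ob g_ob;
    (* (x + y) + z = x + (y + z) on (G × G) × G *)
    g_addA :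
      g_add ∘ pairm P (g_add ∘ pr1 P) (pr2 P)
      = g_add ∘ pairm P (pr1 P ∘ pr1 P) (g_add ∘ pairm P (pr2 P ∘ pr1 P) (pr2 P))
      :> hom (prodo P (prodo P g_ob g_ob) g_ob) g_ob;
    g_add0m : g_add ∘ pairm P (g_zero ∘ to_one P g_ob) (idm g_ob) = idm g_ob;
    g_addm0 : g_add ∘ pairm P (idm g_ob) (g_zero ∘ to_one P g_ob) = idm g_ob;
    g_addNm : g_add ∘ pairm P g_opp (idm g_ob) = g_zero ∘ to_one P g_ob;
    g_addmN : g_add ∘ pairm P (idm g_ob) g_opp = g_zero ∘ to_one P g_ob
  }.
Arguments g_add {D P} _.
Arguments g_zero {D P} _.
Arguments g_opp {D P} _.

Record ab_object (D : category) (P : finite_products D) : Type := AbObject {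
  ab_group :> group_object P;
  ab_addC : g_add ab_group ∘ pairm P (pr2 P) (pr1 P) = g_add ab_group
}.

Record ab_hom (D : category) (P : finite_products D) (A B : ab_object P) :
    Type := AbHom {
  ab_mor :> hom (g_ob A) (g_ob B);
  ab_add : ab_mor ∘ g_add A = g_add B ∘ pairm P (ab_mor ∘ pr1 P) (ab_mor ∘ pr2 P)
}.
Arguments AbHom {D P A B ab_mor} _.

Lemma ab_hom_ext (D : category) (P : finite_products D) (A B : ab_object P)
  (f g : ab_hom A B) : ab_mor f = ab_mor g -> f = g.
Proof.
case: f g => [f ef] [g eg] /= e; subst g.
by rewrite (proof_irrelevance _ ef eg).
Qed.

Lemma pairm_comp (D : category) (P : finite_products D) (V W X Y : D)
    (a : hom W X) (b : hom W Y) (h : hom V W) :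
  pairm P a b ∘ h = pairm P (a ∘ h) (b ∘ h).
Proof. by apply: (@prodo_ext _ P); rewrite composeA ?pr1_pairm ?pr2_pairm. Qed.

Section AbCategory.
Variables (D : category) (P : finite_products D).
Implicit Types A B E F : ab_object P.

Lemma ab_id_add A :
  idm (g_ob A) ∘ g_add A
  = g_add A ∘ pairm P (idm (g_ob A) ∘ pr1 P) (idm (g_ob A) ∘ pr2 P).
Proof.
rewrite compose1m !compose1m -[LHS]composem1; congr (_ ∘ _).
by apply: (@prodo_ext _ P); rewrite ?pr1_pairm ?pr2_pairm composem1.
Qed.

Definition ab_id A : ab_hom A A := AbHom (ab_id_add A).

Lemma ab_comp_add A B E (g : ab_hom B E) (f : ab_hom A B) :
  ab_mor g ∘ ab_mor f ∘ g_add A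
  = g_add E ∘ pairm P (ab_mor g ∘ ab_mor f ∘ pr1 P) (ab_mor g ∘ ab_mor f ∘ pr2 P).
Proof.
rewrite -composeA ab_add composeA ab_add -composeA pairm_comp.
by rewrite -!composeA pr1_pairm pr2_pairm.
Qed.

Definition ab_comp A B E (g : ab_hom B E) (f : ab_hom A B) : ab_hom A E :=
  AbHom (ab_comp_add g f).

Lemma ab_comp1m A B (f : ab_hom A B) : ab_comp (ab_id B) f = f.
Proof. by apply: ab_hom_ext; apply: compose1m. Qed.

Lemma ab_compm1 A B (f : ab_hom A B) : ab_comp f (ab_id A) = f.
Proof. by apply: ab_hom_ext; apply: composem1. Qed.

Lemma ab_compA A B E F (h : ab_hom E F) (g : ab_hom B E) (f : ab_hom A B) :
  ab_comp h (ab_comp g f) = ab_comp (ab_comp h g) f.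
Proof. by apply: ab_hom_ext; apply: composeA. Qed.

Definition ab_category : category := Category ab_comp1m ab_compm1 ab_compA.

Definition ab_forget : functor ab_category D :=
  @Functor ab_category D (fun A : ab_object P => g_ob A)
    (fun A B (f : ab_hom A B) => ab_mor f)
    (fun=> erefl _) (fun _ _ _ _ _ => erefl _).

End AbCategory.

Record is_group_action (D : category) (P : finite_products D)
    (G : group_object P) (Z : D) (t : hom (prodo P (g_ob G) Z) Z) : Prop :=
  IsGroupAction {
    act_zero : t ∘ pairm P (g_zero G ∘ to_one P Z) (idm Z) = idm Z;
    (* (m + n) z = m (n z) on (G × G) × Z *)
    act_add :
      t ∘ pairm P (g_add G ∘ pr1 P) (pr2 P)
      = t ∘ pairm P (pr1 P ∘ pr1 P) (t ∘ pairm P (pr2 P ∘ pr1 P) (pr2 P))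
      :> hom (prodo P (prodo P (g_ob G) (g_ob G)) Z) Z
  }.

(* [Ab(C/X)]; its objects are the Beck modules over [X]. *)
Definition beck_modules (C : category) (P : pullbacks C) (X : C) : category :=
  ab_category (over_products P X).

Definition beck_forget (C : category) (P : pullbacks C) (X : C) :
    functor (beck_modules P X) (overcategory X) :=
  ab_forget (over_products P X).

Definition effective_epi (C : category) (P : pullbacks C) (Z Y : C)
    (p : hom Z Y) : Prop :=
  is_coequalizer (pb_fst (P Z Z Y p p)) (pb_snd (P Z Z Y p p)) p.

(* The products below are those of [C/Y], i.e. fibre products over [Y]. *)
Record beck_torsor (C : category) (P : pullbacks C) (Z Y : C) (p : hom Z Y) :
    Type := BeckTorsor {
  bt_epi : effective_epi P p;
  bt_module : ab_object (over_products P Y);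
  bt_act : hom (prodo (over_products P Y) (g_ob bt_module) (Over p))
               (Over p : overcategory Y);
  bt_action : is_group_action bt_act;
  bt_iso : is_iso (pairm (over_products P Y) bt_act (pr2 (over_products P Y)))
}.

Definition formally_unramified (C : category) (P : pullbacks C) (X : C) : Prop :=
  forall (Z Y : C) (p : hom Z Y), beck_torsor P p ->
    injective (fun h : hom X Z => p ∘ h).

Definition kahler_differentials (C : category) (P : pullbacks C) : Type :=
  forall X : C, left_adjoint (beck_forget P X).

Definition Omega (C : category) (P : pullbacks C) (K : kahler_differentials P)
    (X : C) : beck_modules P X :=
  K X (over_idm X).

(* Main.v *)
(* By adjunction, morphisms Omega_X -> M of Beck modules are the sections of
   M -> X, so Omega_X is initial iff every Beck module over X has only the zero
   section.  An initial Beck module is a zero object, since its identity is the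
   zero endomorphism.
   If X is formally unramified, apply this to M acting on itself: M -> X is a
   torsor (a split epimorphism is effective), and every section of M lifts the
   identity of X, as the zero section does.
   Conversely, if f, g : X -> Z have the same image q in Y for an M-torsor
   Z -> Y, then f = m + g for a unique m : X -> M over q; this m amounts to a
   section of the Beck module q^*M over X, so it is zero and f = g. *)
Require Import Defs.
From mathcomp Require Import ssreflect ssrfun.

Set Implicit Arguments.
Unset Strict Implicit.
Unset Printing Implicit Defensive.

Local Open Scope cat_scope.

(** * The group of generalized elements [W → G] of a group object *)

Section GeneralizedElements.
Variables (D : category) (P : finite_products D) (G : group_object P).

Definition elt_add W (x y : hom W G) : hom W G := g_add G ∘ pairm P x y.
Definition elt_zero W : hom W G := g_zero G ∘ to_one P W.
Definition elt_opp W (x : hom W G) : hom W G := g_opp G ∘ x.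

Lemma elt_add_comp V W (x y : hom W G) (a : hom V W) :
  elt_add x y ∘ a = elt_add (x ∘ a) (y ∘ a).
Proof. by rewrite /elt_add -composeA pairm_comp. Qed.

Lemma elt_zero_comp V W (a : hom V W) : elt_zero W ∘ a = elt_zero V.
Proof.
by rewrite /elt_zero -composeA (to_one_ext (to_one P W ∘ a) (to_one P V)).
Qed.

Lemma elt_opp_comp V W (x : hom W G) (a : hom V W) :
  elt_opp x ∘ a = elt_opp (x ∘ a).
Proof. by rewrite /elt_opp -composeA. Qed.

(** Evaluate the associativity diagram [g_addA] at the triple [((x, y), z)]. *)
Lemma elt_addA W (x y z : hom W G) :
  elt_add (elt_add x y) z = elt_add x (elt_add y z).
Proof.
have := f_equal (fun h => h ∘ pairm P (pairm P x y) z) (g_addA G).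
rewrite -/(elt_add _ _) -!composeA !pairm_comp -!composeA !pairm_comp.
by rewrite -!composeA !(pr1_pairm, pr2_pairm).
Qed.

Lemma elt_add0 W (x : hom W G) : elt_add (elt_zero W) x = x.
Proof.
have := f_equal (fun h => h ∘ x) (g_add0m G).
by rewrite -/(elt_add _ _) elt_add_comp -/(elt_zero _) elt_zero_comp !compose1m.
Qed.

Lemma elt_addr0 W (x : hom W G) : elt_add x (elt_zero W) = x.
Proof.
have := f_equal (fun h => h ∘ x) (g_addm0 G).
by rewrite -/(elt_add _ _) elt_add_comp -/(elt_zero _) elt_zero_comp !compose1m.
Qed.

Lemma elt_addN W (x : hom W G) : elt_add (elt_opp x) x = elt_zero W.
Proof.
have := f_equal (fun h => h ∘ x) (g_addNm G).
by rewrite -/(elt_add _ _) elt_add_comp -/(elt_zero _) elt_zero_comp compose1m.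
Qed.

Lemma elt_addrN W (x : hom W G) : elt_add x (elt_opp x) = elt_zero W.
Proof.
have := f_equal (fun h => h ∘ x) (g_addmN G).
by rewrite -/(elt_add _ _) elt_add_comp -/(elt_zero _) elt_zero_comp compose1m.
Qed.

End GeneralizedElements.

Arguments elt_zero {D P} G W.

Lemma elt_addC (D : category) (P : finite_products D) (A : ab_object P) W
    (x y : hom W (g_ob A)) : elt_add x y = elt_add y x.
Proof.
have := f_equal (fun h => h ∘ pairm P y x) (ab_addC A).
by rewrite -composeA pairm_comp pr1_pairm pr2_pairm.
Qed.

(** * Transport of an abelian group structure to a representing object *)

Section Representation.
Variables (D E : category) (P : finite_products D) (Q : finite_products E).
Variables (F : functor D E) (A : ab_object Q) (B : D).
Variables (phi : forall W, hom W B -> hom (F W) (g_ob A))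
          (psi : forall W, hom (F W) (g_ob A) -> hom W B).
Hypotheses (phiK : forall W, cancel (@phi W) (@psi W))
           (psiK : forall W, cancel (@psi W) (@phi W)).
Hypothesis phi_nat : forall V W (x : hom W B) (a : hom V W),
  phi (x ∘ a) = phi x ∘ fmap F a.

(** Yoneda: [B] represents [W ↦ hom (F W) A], a functor valued in abelian groups, so each operation
    on [B] is the one of [A] applied to universal elements: the two projections, or the identity. *)
Let add : hom (prodo P B B) B := psi (elt_add (phi (pr1 P)) (phi (pr2 P))).
Let zero : hom (one P) B := psi (elt_zero A _).
Let opp : hom B B := psi (elt_opp (phi (idm B))).

Let phi_add W (x y : hom W B) :
  phi (add ∘ pairm P x y) = elt_add (phi x) (phi y).
Proof.
by rewrite phi_nat psiK elt_add_comp -!phi_nat pr1_pairm pr2_pairm.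
Qed.

Let phi_zero W (a : hom W (one P)) : phi (zero ∘ a) = elt_zero A _.
Proof. by rewrite phi_nat psiK elt_zero_comp. Qed.

Let phi_opp W (x : hom W B) : phi (opp ∘ x) = elt_opp (phi x).
Proof. by rewrite phi_nat psiK elt_opp_comp -phi_nat compose1m. Qed.

Let phi_inj W : injective (@phi W) := can_inj (@phiK W).

Lemma rep_addA : add ∘ pairm P (add ∘ pr1 P) (pr2 P)
  = add ∘ pairm P (pr1 P ∘ pr1 P) (add ∘ pairm P (pr2 P ∘ pr1 P) (pr2 P)).
Proof.
apply: phi_inj; rewrite !phi_add !phi_nat psiK elt_add_comp.
exact: elt_addA.
Qed.

Lemma rep_add0m : add ∘ pairm P (zero ∘ to_one P B) (idm B) = idm B.
Proof. by apply: phi_inj; rewrite phi_add phi_zero elt_add0. Qed.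

Lemma rep_addm0 : add ∘ pairm P (idm B) (zero ∘ to_one P B) = idm B.
Proof. by apply: phi_inj; rewrite phi_add phi_zero elt_addr0. Qed.

Lemma rep_addNm : add ∘ pairm P opp (idm B) = zero ∘ to_one P B.
Proof. by apply: phi_inj; rewrite phi_add phi_zero psiK elt_addN. Qed.

Lemma rep_addmN : add ∘ pairm P (idm B) opp = zero ∘ to_one P B.
Proof. by apply: phi_inj; rewrite phi_add phi_zero psiK elt_addrN. Qed.

Definition rep_group : group_object P :=
  GroupObject rep_addA rep_add0m rep_addm0 rep_addNm rep_addmN.

Lemma rep_addC : g_add rep_group ∘ pairm P (pr2 P) (pr1 P) = g_add rep_group.
Proof. by apply: phi_inj; rewrite phi_add elt_addC psiK. Qed.

Definition rep_ab : ab_object P := AbObject rep_addC.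

Lemma rep_elt_zero W : phi (elt_zero rep_ab W) = elt_zero A (F W).
Proof. exact: phi_zero. Qed.

End Representation.

(** * Pullback of Beck modules along a morphism *)

Section BaseChange.
Variables (C : category) (P : pullbacks C) (X Y : C) (q : hom X Y).

(** Composition with [q] is left adjoint to pullback along [q]; this adjunction is the
    representation that gives the pullback its group structure. *)
Definition sigma_ob (W : overcategory X) : overcategory Y :=
  Over (q ∘ over_arr W).

Lemma sigma_comm (V W : overcategory X) (a : hom V W) :
  over_arr (sigma_ob W) ∘ over_mor a = over_arr (sigma_ob V).
Proof. by rewrite /= -composeA over_comm. Qed.

Definition sigma_mor (V W : overcategory X) (a : hom V W) :
  hom (sigma_ob V) (sigma_ob W) :=
  @OverHom _ _ (sigma_ob V) (sigma_ob W) (over_mor a) (sigma_comm a).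

Lemma sigma_mor1 (W : overcategory X) : sigma_mor (idm W) = idm (sigma_ob W).
Proof. exact: over_hom_ext. Qed.

Lemma sigma_morM (U V W : overcategory X) (b : hom V W) (a : hom U V) :
  sigma_mor (b ∘ a) = sigma_mor b ∘ sigma_mor a.
Proof. exact: over_hom_ext. Qed.

Definition sigma : functor (overcategory X) (overcategory Y) :=
  Functor sigma_mor1 sigma_morM.

Variable M : ab_object (over_products P Y).

Let pb := P q (over_arr (g_ob M)).
Definition base_change_ob : overcategory X := Over (pb_fst pb).

Lemma from_base_change_comm W (x : hom W base_change_ob) :
  over_arr (g_ob M) ∘ (pb_snd pb ∘ over_mor x) = over_arr (sigma W).
Proof. by rewrite composeA -pb_comm -composeA (over_comm x). Qed.

Definition from_base_change W (x : hom W base_change_ob) :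
  hom (sigma W) (g_ob M) :=
  @OverHom _ _ (sigma W) (g_ob M) _ (from_base_change_comm x).

Lemma to_base_change_comm W (y : hom (sigma W) (g_ob M)) :
  over_arr base_change_ob ∘ pb_pair pb (esym (over_comm y)) = over_arr W.
Proof. exact: pb_fst_pair. Qed.

Definition to_base_change W (y : hom (sigma W) (g_ob M)) :
  hom W base_change_ob :=
  @OverHom _ _ W base_change_ob _ (to_base_change_comm y).

Lemma from_base_changeK W : cancel (@from_base_change W) (@to_base_change W).
Proof.
move=> x; apply: over_hom_ext; apply: (@pb_ext _ _ _ _ _ _ pb).
  by rewrite /= pb_fst_pair -(over_comm x).
by rewrite /= pb_snd_pair.
Qed.

Lemma to_base_changeK W : cancel (@to_base_change W) (@from_base_change W).
Proof. by move=> y; apply: over_hom_ext; apply: pb_snd_pair. Qed.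

Lemma from_base_change_nat V W (x : hom W base_change_ob) (a : hom V W) :
  from_base_change (x ∘ a) = from_base_change x ∘ fmap sigma a.
Proof. by apply: over_hom_ext; apply: composeA. Qed.

Definition base_change : ab_object (over_products P X) :=
  rep_ab (over_products P X) from_base_changeK to_base_changeK
    from_base_change_nat.

(** A morphism [X → M] over [q] is the same as a section of the pulled back module, and the
    adjunction bijection preserves zero. *)
Lemma zero_section_base_change (y : hom (sigma (over_idm X)) (g_ob M)) :
  (forall s : hom (over_idm X) (g_ob base_change),
      s = elt_zero base_change (over_idm X)) ->
  y = elt_zero M (sigma (over_idm X)).
Proof.
by move=> /(_ (to_base_change y)) e; rewrite -[y]to_base_changeK e rep_elt_zero.
Qed.

End BaseChange.

(** * A Beck module as a torsor under itself *)

Section SelfTorsor.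
Variables (C : category) (P : pullbacks C).

Lemma split_epi_effective (Z Y : C) (p : hom Z Y) (s : hom Y Z) :
  p ∘ s = idm Y -> effective_epi P p.
Proof.
move=> ps; split; first exact: pb_comm.
move=> W t tuv; exists (t ∘ s); split; last first.
  by move=> h <-; rewrite -composeA ps composem1.
(* The pair [(s ∘ p, idm Z)] factors through the kernel pair of [p], so [t] takes the same value on
   both components: [t ∘ s ∘ p = t]. *)
have e : p ∘ (s ∘ p) = p ∘ idm Z by rewrite composeA ps compose1m composem1.
rewrite -composeA -(pb_fst_pair (P p p) e) composeA tuv -composeA pb_snd_pair.
exact: composem1.
Qed.

(* A morphism with target [A] has the form [Over p] only after destructing [A]. *)
Lemma beck_torsor_over (Y : C) (A : overcategory Y)
    (M : ab_object (over_products P Y))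
    (t : hom (prodo (over_products P Y) (g_ob M) A) A) :
  effective_epi P (over_arr A) -> is_group_action t ->
  is_iso (pairm (over_products P Y) t (pr2 (over_products P Y))) ->
  beck_torsor P (over_arr A).
Proof. by case: A t => Z p t epi act iso; apply: (BeckTorsor epi act iso). Qed.

Variables (X : C) (M : ab_object (over_products P X)).
Let Q := over_products P X.

Lemma add_is_group_action : is_group_action (g_add M).
Proof. by split; [exact: g_add0m | exact: g_addA]. Qed.

Lemma shear_iso : is_iso (pairm Q (g_add M) (pr2 Q)).
Proof.
(* The shear [(x, y) ↦ (x + y, y)] has inverse [(x, y) ↦ (x - y, y)]. *)
exists (pairm Q (elt_add (pr1 Q) (elt_opp (pr2 Q))) (pr2 Q)).
have addE : g_add M = elt_add (pr1 Q) (pr2 Q).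
  rewrite /elt_add -[LHS]composem1; congr (_ ∘ _).
  by apply: (@prodo_ext _ Q); rewrite ?pr1_pairm ?pr2_pairm composem1.
rewrite {1 2}addE.
split; apply: (@prodo_ext _ Q); rewrite composem1 pairm_comp
  ?pr1_pairm ?pr2_pairm //.
  rewrite elt_add_comp elt_opp_comp pr1_pairm pr2_pairm.
  by rewrite elt_addA elt_addrN elt_addr0.
rewrite elt_add_comp pr1_pairm pr2_pairm.
by rewrite elt_addA elt_addN elt_addr0.
Qed.

Lemma self_torsor : beck_torsor P (over_arr (g_ob M)).
Proof.
apply: beck_torsor_over add_is_group_action shear_iso.
(* The zero section splits [M → X]. *)
exact: (split_epi_effective (over_comm (g_zero M))).
Qed.

Lemma unramified_sections (s : hom (over_idm X) (g_ob M)) :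
  formally_unramified P X -> s = elt_zero M (over_idm X).
Proof.
move=> unr; apply: over_hom_ext; apply: (unr _ _ _ self_torsor).
exact: etrans (over_comm s) (esym (over_comm (elt_zero M (over_idm X)))).
Qed.

End SelfTorsor.

(** * Zero morphisms and initial abelian group objects *)

Section ZeroMorphism.
Variables (D : category) (P : finite_products D) (A B : ab_object P).

Lemma zero_mor_add : elt_zero B (g_ob A) ∘ g_add A
  = g_add B ∘ pairm P (elt_zero B (g_ob A) ∘ pr1 P)
                      (elt_zero B (g_ob A) ∘ pr2 P).
Proof. by rewrite !elt_zero_comp -/(elt_add _ _) elt_add0. Qed.

Definition zero_mor : hom (A : ab_category P) B := AbHom zero_mor_add.

End ZeroMorphism.

Lemma initial_ab_zero (D : category) (P : finite_products D)
  (A : ab_category P) : is_initial A -> is_zero_object A.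
Proof.
move=> iA; split=> // B; exists (zero_mor B A); split=> // f _.
have [z [_ uz]] := iA A.
have e : zero_mor A A = idm A by rewrite -(uz (zero_mor A A) I) -(uz (idm A) I).
(* For [f : B → A], [f = idm A ∘ f = 0 ∘ f = 0]. *)
rewrite -[RHS]compose1m -e; apply: ab_hom_ext.
by symmetry; apply: elt_zero_comp.
Qed.

(** * Vanishing of sections, differentials and torsors *)

Lemma Omega_initial_sections (C : category) (P : pullbacks C)
    (K : kahler_differentials P) (X : C) :
  is_initial (Omega K X) <->
  forall (M : ab_object (over_products P X))
         (s : hom (over_idm X) (g_ob M)), s = elt_zero M (over_idm X).
Proof.
split=> [iO M s|sec M].
  (* [tr], inverse to [transpose], sends sections of [M] to morphisms out of [Omega K X]; initiality
     makes the images of [s] and of the zero section equal. *)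
  have [tr trK Ktr] := transpose_bij (K X) (over_idm X) M.
  have [z [_ uz]] := iO M.
  rewrite -[s]Ktr -[RHS]Ktr.
  by rewrite -(uz (tr s) I) -(uz (tr (elt_zero M _)) I).
have [tr trK Ktr] := transpose_bij (K X) (over_idm X) M.
exists (tr (elt_zero M _)); split=> // f _.
by rewrite -(sec M (transpose f)) trK.
Qed.

Lemma torsor_unramified (C : category) (P : pullbacks C) (X Z Y : C)
    (p : hom Z Y) :
  (forall (M : ab_object (over_products P X))
          (s : hom (over_idm X) (g_ob M)), s = elt_zero M (over_idm X)) ->
  beck_torsor P p -> injective (fun h : hom X Z => p ∘ h).
Proof.
move=> sec [_ M t act [inv [_ shearK]]] f g /= pfg.
pose Q := over_products P Y.
(* [S] is [X] seen over [Y] through [q = p ∘ g]; by [pfg], both [f] and [g] are morphisms from [S]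
   to [Z] over [Y]. *)
pose S := sigma (p ∘ g) (over_idm X).
have fS : over_arr (Over p) ∘ f = over_arr S by rewrite /= composem1.
have gS : over_arr (Over p) ∘ g = over_arr S by rewrite /= composem1.
pose f' : hom S (Over p : overcategory Y) := @OverHom _ _ S (Over p) _ fS.
pose g' : hom S (Over p : overcategory Y) := @OverHom _ _ S (Over p) _ gS.
suff : f' = g' by move/(f_equal (@over_mor _ _ _ _)).
(* [w] is the pair [(m, g)] with [m + g = f], obtained by inverting the shear at [(f, g)]. *)
pose w := inv ∘ pairm Q f' g'.
have ew : pairm Q t (pr2 Q) ∘ w = pairm Q f' g'.
  by rewrite /w composeA shearK compose1m.
have tw : t ∘ w = f'.
  by rewrite -(pr1_pairm Q f' g') -ew composeA pr1_pairm.
have gw : pr2 Q ∘ w = g'.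
  by rewrite -(pr2_pairm Q f' g') -ew composeA pr2_pairm.
have m0 : pr1 Q ∘ w = elt_zero M S by apply: zero_section_base_change.
(* Since [m = 0], [w] is [(0, g)], and the unit law of the action then gives [f = 0 + g = g]. *)
have e0 : pairm Q (g_zero M ∘ to_one Q _) (idm _) ∘ g' = w.
  apply: (@prodo_ext _ Q); rewrite composeA ?pr1_pairm ?pr2_pairm.
    by rewrite m0 -/(elt_zero _ _) elt_zero_comp.
  by rewrite gw compose1m.
by rewrite -tw -e0 composeA (act_zero act) compose1m.
Qed.

Theorem theorem4p2 (C : category) (P : pullbacks C)
    (K : kahler_differentials P) (X : C) :
  formally_unramified P X <-> is_zero_object (Omega K X).
Proof.
split=> [unr|[/Omega_initial_sections sec _] Z Y p].
  apply/initial_ab_zero/Omega_initial_sections => M s.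
  exact: unramified_sections.
exact: torsor_unramified.
Qed.
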